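(* Let $\mu=l_1+l_2+l_3$ be a symmetric Lie $2$-algebra structure on a graded vector space $E=E_{-2}\oplus E_{-1}$ and let $\alpha$ be a symmetric vector valued $2$-form of degree $0$ on $E$. Let $S$ be the Euler map of $E$. Then $S+\alpha$ is a Nijenhuis vector valued form with respect to $\mu$ with square $S+2\alpha$ if and only if $$\alpha(l_1\alpha(X,Y),Z)+\alpha(l_1\alpha(Y,Z),X)+\alpha(l_1\alpha(Z,X),Y)=0$$ for all $X,Y,Z\in E_{-1}$.
   Context: Let $E=\oplus_{i\in\mathbb Z}E_i$ be a graded vector space over $\mathbb R$ or $\mathbb C$; $|X|$ is the degree of homogeneous $X$. A symmetric vector valued $k$-form is a graded symmetric $k$-linear map $K:E^{k}\to E$ (exchanging adjacent arguments $X,Y$ gives the sign $(-1)^{|X||Y|}$). It has degree $\bar K$ if $|K(X_1,\dots,X_k)|=|X_1|+\dots+|X_k|+\bar K$. For a $k$-form $K$ and $l$-form $L$, $$\iota_KL(X_1,\dots,X_{k+l-1})=\sum_{\sigma\in Sh(k,l-1)}\epsilon(\sigma)L(K(X_{\sigma(1)},\dots,X_{\sigma(k)}),X_{\sigma(k+1)},\dots,X_{\sigma(k+l-1)}),$$ with $Sh(k,l-1)$ the $(k,l-1)$-unshuffles and $\epsilon(\sigma)$ the Koszul sign. The Richardson–Nijenhuis bracket is $[K,L]_{_{RN}}=\iota_KL-(-1)^{\bar K\bar L}\iota_LK$, extended bilinearly to sums of forms. A symmetric $L_\infty$-structure is $\mu=\sum_{i\ge1}l_i$ with $l_i$ a symmetric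 vector valued $i$-form of degree $+1$ and $[\mu,\mu]_{_{RN}}=0$. A symmetric Lie $2$-algebra is an $L_\infty$-algebra whose graded vector space is concentrated in degrees $-2,-1$ (so only $l_1,l_2,l_3$ can be non-zero). For $\mu$ of degree $1$, a symmetric vector valued form $\mathcal N$ of degree $0$ is Nijenhuis with respect to $\mu$ with square $\mathcal K$ if $\mathcal K$ has degree $0$, $[\mathcal N,[\mathcal N,\mu]_{_{RN}}]_{_{RN}}=[\mathcal K,\mu]_{_{RN}}$ and $[\mathcal N,\mathcal K]_{_{RN}}=0$. Euler map: $S(X)=-|X|X$ for homogeneous $X$. *)

(* Defs.v *)
From mathcomp Require Import all_boot all_order all_algebra perm.
From mathcomp Require Import boolp classical_sets functions cardinality fsbigop.
From mathcomp Require Import reals.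
From mathcomp.real_closed Require Import complex.

Set Implicit Arguments.
Unset Strict Implicit.
Unset Printing Implicit Defensive.

Import Order.TTheory GRing.Theory Num.Theory.

Local Open Scope classical_set_scope.
Local Open Scope ring_scope.

Variant ground := RealGround | ComplexGround.

Definition ground_field (R : realType) (g : ground) : fieldType :=
  match g with RealGround => R | ComplexGround => complex R end.

(* A decomposition E = (+)_(i : int) E_i, presented by the projections
   gproj i of E onto E_i; the E_i may be infinite dimensional. *)
Record gradedSpace (F : fieldType) := GradedSpace {
  gcarrier :> lmodType F;
  gproj : int -> {linear gcarrier -> gcarrier};
  gproj_orth : forall (i j : int) (x : gcarrier),
    gproj i (gproj j x) = if i == j then gproj j x else 0;
  gproj_finite : forall x : gcarrier, finite_set [set i | gproj i x != 0];
  gproj_sum : forall x : gcarrier, x = \sum_(i \in [set: int]) gproj i x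
}.

Section Forms.
Variables (F : fieldType) (E : gradedSpace F).

(* x \in E_i *)
Definition homog (i : int) (x : E) : Prop := gproj E i x = x.

Definition concentrated (s : seq int) : Prop :=
  forall (i : int) (x : E), homog i x -> i \notin s -> x = 0.

(* As seq E is the disjoint union of the E^k, a map seq E -> E is a family of
   maps E^k -> E, i.e. a formal sum over k of (not yet multilinear) vector
   valued k-forms.  The k-forms themselves are the maps vanishing on E^n for
   all n != k, so that sums of forms are pointwise sums. *)
Definition vvform : lmodType F := seq E -> E.

Definition has_arity (k : nat) (K : vvform) : Prop :=
  forall X : seq E, size X != k -> K X = 0.

Definition multilinear (K : vvform) : Prop :=
  forall (U V : seq E) (a : F) (x y : E),
    K (U ++ (a *: x + y) :: V) = a *: K (U ++ x :: V) + K (U ++ y :: V).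

Definition graded_symmetric (K : vvform) : Prop :=
  forall (U V : seq E) (p q : int) (x y : E), homog p x -> homog q y ->
    K (U ++ y :: x :: V) = (-1) ^ (p * q) *: K (U ++ x :: y :: V).

Definition has_degree (D : int) (K : vvform) : Prop :=
  forall (d : seq int) (X : seq E), size d = size X ->
    (forall i : nat, (i < size X)%N -> homog d`_i X`_i) ->
    homog (\sum_(e <- d) e + D) (K X).

Definition symmetric_form (D : int) (K : vvform) : Prop :=
  [/\ multilinear K, graded_symmetric K & has_degree D K].

Definition symmetric_kform (k : nat) (D : int) (K : vvform) : Prop :=
  has_arity k K /\ symmetric_form D K.

Definition unshuffle (n k : nat) (s : 'S_n) : bool :=
  [forall i : 'I_n, forall j : 'I_n,
     (i < j)%N && ((j < k)%N || (k <= i)%N) ==> (s i < s j)%N].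

Definition koszul_sign (n : nat) (d : 'I_n -> int) (s : 'S_n) : F :=
  \prod_(i < n) \prod_(j < n | (i < j)%N && (s j < s i)%N)
     (-1) ^ (d (s i) * d (s j)).

(* The insertion for arguments x_i of degree d i.  The k-th summand only
   involves the k-form component of K and the (n - k + 1)-form component
   of L. *)
Definition insertion_homog (K L : vvform) (n : nat) (d : 'I_n -> int)
    (x : 'I_n -> E) : E :=
  \sum_(k < n.+1) \sum_(s : 'S_n | unshuffle k s)
    koszul_sign d s *:
      L (K [seq x (s i) | i : 'I_n <- enum 'I_n & (i < k)%N]
           :: [seq x (s i) | i : 'I_n <- enum 'I_n & (k <= i)%N]).

(* iota_K L.  The Koszul sign only makes sense for homogeneous arguments, so
   each argument is split into its homogeneous components; for forms that
   vanish as soon as one argument does, the sum over d has finite support. *)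
Definition insertion (K L : vvform) : vvform := fun X : seq E =>
  \sum_(d \in [set: {ffun 'I_(size X) -> int}])
    insertion_homog K L d (fun i => gproj E (d i) X`_i).

(* The bracket of K of degree p and L of degree q.  The degrees are passed
   explicitly, as a form does not determine its degree (it may be zero). *)
Definition rn_bracket (p q : int) (K L : vvform) : vvform :=
  insertion K L - (-1) ^ (p * q) *: insertion L K.

(* mu [::] = 0 says that mu has no 0-form component. *)
Definition Linfty (mu : vvform) : Prop :=
  [/\ mu [::] = 0, symmetric_form 1 mu & rn_bracket 1 1 mu mu = 0].

(* For mu of degree 1. *)
Definition Nijenhuis_with_square (mu N K : vvform) : Prop :=
  [/\ symmetric_form 0 N, symmetric_form 0 K,
      rn_bracket 0 1 N (rn_bracket 0 1 N mu) = rn_bracket 0 1 K mu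
    & rn_bracket 0 0 N K = 0].

(* On homogeneous x only the summand i = |x| survives. *)
Definition euler : vvform := fun X : seq E =>
  if X is [:: x] then \sum_(i \in [set: int]) (- i)%:~R *: gproj E i x else 0.

End Forms.

Arguments euler {F} E.

(* Main.v *)
Require Import Defs.
From mathcomp Require Import all_boot all_order all_algebra.
From mathcomp Require Import reals.
From mathcomp Require Import fingroup perm boolp classical_sets functions.
From mathcomp Require Import fsbigop zify ring.
From mathcomp.real_closed Require Import complex.
Import Defs.

Import Order.TTheory GRing.Theory Num.Theory.
Local Open Scope ring_scope.

(** Write S for the Euler map and [-,-] for the bracket.  On a form L of degree
    q, iota_S L scales L(X_1, ..., X_k) by minus the total degree of the
    arguments and iota_L S by minus the degree of the value, which is q more;
    hence [S, L] = q L (rn_bracket_euler).  With N = S + alpha and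
    K = S + 2 alpha this gives, as mu has degree 1,

      [N, [N, mu]] = mu + 2 [alpha, mu] + [alpha, [alpha, mu]],
      [K, mu]      = mu + 2 [alpha, mu],

    while [N, K] = 0 because [S, S], [S, alpha], [alpha, S] and [alpha, alpha]
    all vanish.  So N is Nijenhuis with square K exactly when
    [alpha, [alpha, mu]] = 0 (Nijenhuis_double_bracket).

    For degree reasons this double bracket lives on three arguments of degree
    -1: a form of degree 1 sends homogeneous arguments of total degree at most
    -4 to degree at most -3, where E vanishes, and alpha inserted twice leaves
    nothing on fewer than three arguments.  On E_{-1} its value is -2 times the
    cyclic sum of alpha(l_1 alpha(X, Y), Z) (double_bracket3), and 2 is
    invertible.

    These computations rest on a calculus of insertions.  Multilinear forms may
    be compared on homogeneous arguments of negative degree (multilinear_ext),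
    where the sum over degree assignments collapses (insertion_homogE); for
    this, an insertion has to be multilinear again.  For [S, [alpha, mu]] it
    also has to be symmetric and of the expected degree.  Symmetry is proved
    for total degree at most 1: in that range a form vanishes on four or more
    homogeneous arguments of negative degree, so that the explicit unshuffle
    expansions on at most three arguments (insertion0 to insertion3) suffice. *)

(** * Permutations and unshuffles of at most three elements *)

(** Every permutation of n + 1 points is determined by the image j of the first
    point and a permutation of the n others; iterating this turns a sum over a
    small symmetric group into an explicit one. *)
Lemma big_lift_perm (V : nmodType) (n : nat) (G : 'S_n.+1 -> V) :
  \sum_s G s = \sum_j \sum_(t : 'S_n) G (lift_perm ord0 j t).
Proof.
rewrite pair_bigA /= (reindex (fun p : 'I_n.+1 * 'S_n => lift_perm ord0 p.1 p.2)) //=.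
apply: onW_bij; apply: inj_card_bij; last first.
  by rewrite card_prod !card_Sn card_ord factS.
move=> [j t] [j' t'] /= /permP e.
have ejj' : j = j' by have := e ord0; rewrite !lift_perm_id.
rewrite -{}ejj' in e *; congr pair; apply/permP => i.
by have := e (lift ord0 i); rewrite !lift_perm_lift => /lift_inj.
Qed.

Lemma big_perm0 (V : nmodType) (G : 'S_0 -> V) : \sum_s G s = G (1%g : {perm _}).
Proof.
rewrite (bigD1 (1%g : {perm _})) //= big1 ?addr0 // => s /negP[]; apply/eqP/permP.
by case.
Qed.

Lemma forall_ordS n (P : pred 'I_n.+1) :
  [forall i, P i] = P ord0 && [forall i, P (lift ord0 i)].
Proof.
apply/forallP/andP => [h|[h0 /forallP h] i]; first by split=> //; apply/forallP.
by case: (unliftP ord0 i) => [j ->|->].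
Qed.

Lemma forall_ord0 (P : pred 'I_0) : [forall i, P i].
Proof. by apply/forallP; case. Qed.

Lemma enum_ord0 : enum 'I_0 = [::].
Proof. by apply: size0nil; rewrite size_enum_ord. Qed.

Lemma big_perm3 (V : nmodType) (P : pred 'S_3) (G : 'S_3 -> V) :
  let p i j := lift_perm ord0 i (lift_perm ord0 j (lift_perm ord0 ord0 1%g)) in
  \sum_(s | P s) G s = \sum_i \sum_j if P (p i j) then G (p i j) else 0.
Proof.
rewrite /= big_mkcond big_lift_perm; apply: eq_bigr => i _.
rewrite big_lift_perm; apply: eq_bigr => j _.
by rewrite big_lift_perm big_ord_recl big_ord0 addr0 big_perm0.
Qed.

(** The monotonicity conditions in a form that computes on explicit
    permutations. *)
Lemma unshuffle3 k (s : 'S_3) :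
  let i0 := s ord0 in let i1 := s (lift ord0 ord0) in
  let i2 := s (lift ord0 (lift ord0 ord0)) in
  unshuffle k s = [&& (1 < k)%N || (k <= 0)%N ==> (i0 < i1)%N,
    (2 < k)%N || (k <= 0)%N ==> (i0 < i2)%N & (2 < k)%N || (k <= 1)%N ==> (i1 < i2)%N].
Proof.
rewrite /unshuffle !forall_ordS !forall_ord0 /=.
by rewrite !andbT -!andbA.
Qed.

(** Used to locate the one argument that varies inside the argument list of a
    multilinear form. *)
Lemma map_splice (I : eqType) (T : Type) (f : I -> T) (r : seq I) (i0 : I) :
  uniq r -> i0 \in r ->
  exists U V, forall g, (forall i, i != i0 -> g i = f i) -> map g r = U ++ g i0 :: V.
Proof.
move=> + /splitPr e; case: e => r1 r2.
rewrite cat_uniq /= => /and3P[_ /norP[i0r1 _] /andP[i0r2 _]].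
exists (map f r1), (map f r2) => g eg; rewrite map_cat /=; congr (_ ++ _ :: _).
  by apply/eq_in_map => i ir; apply: eg; apply: contraNneq i0r1 => <-.
by apply/eq_in_map => i ir; apply: eg; apply: contraNneq i0r2 => <-.
Qed.

(** * Homogeneous elements and multilinear forms *)

Section GradedForms.
Local Set Implicit Arguments.
Local Unset Strict Implicit.
Variables (F : fieldType) (E : gradedSpace F).
Implicit Types K L M : vvform E.

Lemma vvformE :
  (forall K L X, (K - L) X = K X - L X) * (forall K L X, (K + L) X = K X + L X)
  * (forall a K X, (a *: K) X = a *: K X) * (forall X, (0 : vvform E) X = 0).
Proof. by []. Qed.

Lemma homog0 i : homog i (0 : E).
Proof. exact: linear0. Qed.

Lemma homogD i (x y : E) : homog i x -> homog i y -> homog i (x + y).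
Proof. by rewrite /homog linearD => -> ->. Qed.

Lemma homogZ i a (x : E) : homog i x -> homog i (a *: x).
Proof. by rewrite /homog linearZ => ->. Qed.

Lemma homog_sum i (I : Type) (r : seq I) (P : pred I) (f : I -> E) :
  (forall j, P j -> homog i (f j)) -> homog i (\sum_(j <- r | P j) f j).
Proof. by move=> h; apply: big_ind => //; [exact: homog0|exact: homogD]. Qed.

Lemma homog_gproj i (x : E) : homog i (gproj E i x).
Proof. by rewrite /homog gproj_orth eqxx. Qed.

Lemma gproj_homog i j (x : E) : homog j x -> gproj E i x = if i == j then x else 0.
Proof. by move=> hx; rewrite -{1}hx gproj_orth hx. Qed.

(** The hypothesis of has_degree, in a form that can be destructed along with
    the list of arguments. *)
Fixpoint homog_seq (d : seq int) (X : seq E) : Prop :=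
  match d, X with
  | [::], [::] => True
  | i :: d', x :: X' => homog i x /\ homog_seq d' X'
  | _, _ => False
  end.

Lemma homog_seqP d X : homog_seq d X <->
  size d = size X /\ (forall i : nat, (i < size X)%N -> homog d`_i X`_i).
Proof.
elim: d X => [|i d IHd] [|x X] //=; try by split=> // -[].
split=> [[hx /IHd [-> h]]|[[sdX] h]]; first by split=> // -[].
by split; [exact: (h 0%N)|apply/IHd; split=> // j; exact: (h j.+1)].
Qed.

Lemma homog_seq_cat d d' X X' :
  homog_seq d X -> homog_seq d' X' -> homog_seq (d ++ d') (X ++ X').
Proof. by elim: d X => [|i d IHd] [|x X] //= [hx hX] hX'; split=> //; apply: IHd. Qed.

Lemma homog_seq_map (I : Type) (r : seq I) (d : I -> int) (x : I -> E) :
  (forall i, homog (d i) (x i)) -> homog_seq (map d r) (map x r).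
Proof. by move=> h; elim: r => //= i r IHr; split. Qed.

Lemma has_degreeP D K :
  has_degree D K <-> (forall d X, homog_seq d X -> homog (\sum_(e <- d) e + D) (K X)).
Proof.
split=> h d X; first by move/homog_seqP => [sdX hX]; apply: h.
by move=> sdX hX; apply: h; apply/homog_seqP.
Qed.

Lemma multilinearD K U V x y : multilinear K ->
  K (U ++ (x + y) :: V) = K (U ++ x :: V) + K (U ++ y :: V).
Proof. by move=> mK; rewrite -[x]scale1r mK !scale1r. Qed.

Lemma multilinear0 K U V : multilinear K -> K (U ++ 0 :: V) = 0.
Proof.
by move=> mK; have := mK U V (-1) 0 0; rewrite scaler0 addr0 scaleN1r addNr.
Qed.

Lemma multilinear0_head K V : multilinear K -> K (0 :: V) = 0.
Proof. exact: (@multilinear0 _ [::]). Qed.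

Lemma multilinearZ_head K V a x : multilinear K -> K (a *: x :: V) = a *: K (x :: V).
Proof.
move=> mK; have := mK [::] V a x 0; rewrite addr0 /= => ->.
by rewrite (@multilinear0 _ [::]) // addr0.
Qed.

Lemma multilinearN_head K V x : multilinear K -> K (- x :: V) = - K (x :: V).
Proof. by move=> mK; rewrite -scaleN1r multilinearZ_head // scaleN1r. Qed.

Lemma multilinear_comb a K L : multilinear K -> multilinear L -> multilinear (a *: K + L).
Proof.
move=> mK mL U V b x y; rewrite !vvformE mK mL !scalerDr !scalerA mulrC.
by rewrite addrACA.
Qed.

Lemma symmetric_form_comb D a K L :
  symmetric_form D K -> symmetric_form D L -> symmetric_form D (a *: K + L).
Proof.
move=> [mK sK dK] [mL sL dL]; split; first exact: multilinear_comb.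
  move=> U V p q x y hx hy; rewrite !vvformE (sK _ _ p q) // (sL _ _ p q) //.
  by rewrite scalerDr !scalerA mulrC.
move=> d X sdX hX; rewrite vvformE; apply: homogD; last exact: dL.
by apply: homogZ; exact: dK.
Qed.

(** * Insertions of homogeneous arguments *)

(** In each summand the index j sits in exactly one of the two blocks of the
    unshuffle, so it is an argument either of the inner form K or of L. *)
Lemma insertion_homog_multilinear K L n (d : 'I_n -> int) (x y z : 'I_n -> E) a j :
  multilinear K -> multilinear L ->
  z j = a *: x j + y j ->
  (forall i, i != j -> y i = x i) -> (forall i, i != j -> z i = x i) ->
  insertion_homog K L d z = a *: insertion_homog K L d x + insertion_homog K L d y.
Proof.
move=> mK mL zj yx zx; rewrite /insertion_homog scaler_sumr -big_split.
apply: eq_bigr => k _; rewrite scaler_sumr -big_split.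
apply: eq_bigr => s _; rewrite /= scalerA mulrC -scalerA -scalerDr; congr (_ *: _).
set i0 := (s^-1)%g j.
have si0 : s i0 = j by rewrite permKV.
have sne i : i != i0 -> s i != j by apply: contraNneq => sij; rewrite /i0 -sij permK.
have fix_map (P : pred 'I_n) (w : 'I_n -> E) : ~~ P i0 -> (forall i, i != j -> w i = x i) ->
    [seq w (s i) | i <- enum 'I_n & P i] = [seq x (s i) | i <- enum 'I_n & P i].
  move=> Pi0 wx; apply/eq_in_map => i; rewrite mem_filter => /andP[Pi _].
  by apply/wx/sne; apply: contraNneq Pi0 => <-.
have cut_map (P : pred 'I_n) : P i0 -> exists U V, forall w : 'I_n -> E,
    (forall i, i != j -> w i = x i) -> [seq w (s i) | i <- enum 'I_n & P i] = U ++ w j :: V.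
  move=> Pi0.
  have [||U [V UV]] :=
      @map_splice _ _ (fun i => x (s i)) [seq i <- enum 'I_n | P i] i0.
  - by rewrite filter_uniq // enum_uniq.
  - by rewrite mem_filter Pi0 mem_enum.
  by exists U, V => w wx; rewrite UV ?si0 // => i /sne /wx.
have [i0k|ki0] := ltnP i0 k.
  have [U [V UV]] := cut_map (fun i => (i < k)%N) i0k.
  rewrite !UV // zj mK.
  rewrite !(fix_map (fun i => (k <= i)%N) z) -?ltnNge //.
  rewrite (fix_map (fun i => (k <= i)%N) y) -?ltnNge //.
  by have := mL [::]; apply.
have [U [V UV]] := cut_map (fun i => (k <= i)%N) ki0.
rewrite !UV // zj !(fix_map (fun i => (i < k)%N) z) -?leqNgt //.
rewrite (fix_map (fun i => (i < k)%N) y) -?leqNgt //.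
by rewrite -!cat_cons mL.
Qed.

(** Linearity with a = -1 and x = y = z. *)
Lemma insertion_homog0 K L n (d : 'I_n -> int) (x : 'I_n -> E) j :
  multilinear K -> multilinear L -> x j = 0 -> insertion_homog K L d x = 0.
Proof.
move=> mK mL xj.
rewrite (@insertion_homog_multilinear K L n d x x x (-1) j) ?scaleN1r ?addNr //.
Qed.

(** An argument of degree i has no components of other degrees, hence only the
    term of index d survives in the sum over all degree assignments. *)
Lemma insertion_homogE K L n d X : multilinear K -> multilinear L ->
  size X = n -> homog_seq d X ->
  insertion K L X = insertion_homog K L (fun i : 'I_n => d`_i) (fun i : 'I_n => X`_i).
Proof.
move=> mK mL <- /homog_seqP[sdX hX]; rewrite /insertion.
pose d0 := [ffun i : 'I_(size X) => d`_i].
rewrite -(@fsbig_widen _ _ _ _ [set d0]) //; last first.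
  move=> d1 [_ /= d1d0].
  have [i d1i] : exists i, d1 i != d0 i.
    apply/existsP; rewrite -negb_forall; apply: contra_notN d1d0 => /forallP h.
    by apply/ffunP => i; apply/eqP.
  apply: (@insertion_homog0 _ _ _ _ _ i) => //=.
  by rewrite (gproj_homog _ (hX i (ltn_ord i))); rewrite /d0 ffunE in d1i; rewrite (negPf d1i).
rewrite fsbig_set1; congr insertion_homog; apply/funext => i; rewrite ffunE //.
by rewrite hX.
Qed.

Lemma insertion_homog_degree K L p q n (d : 'I_n -> int) (x : 'I_n -> E) :
  has_degree p K -> has_degree q L -> (forall i, homog (d i) (x i)) ->
  homog (\sum_i d i + (p + q)) (insertion_homog K L d x).
Proof.
move=> /has_degreeP dK /has_degreeP dL hx.
apply: homog_sum => k _; apply: homog_sum => s _; apply: homogZ.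
have hmap := fun r => @homog_seq_map _ r (d \o s) (x \o s) (fun i => hx (s i)).
have := dL (_ :: _) (_ :: _) (conj (dK _ _ (hmap [seq i : 'I_n <- enum 'I_n | (i < k)%N]))
  (hmap [seq i : 'I_n <- enum 'I_n | (k <= i)%N])).
congr homog; rewrite big_cons !big_map !big_filter !big_enum_cond /=.
rewrite [in RHS](reindex_inj (@perm_inj _ s)) /=.
rewrite [in RHS](bigID (fun i : 'I_n => (i < k)%N)) /=.
rewrite [X in _ = (_ + X) + _](eq_bigl (fun i : 'I_n => (k <= i)%N)); last first.
  by move=> i; rewrite -leqNgt.
ring.
Qed.

Lemma insertion_degree K L p q : multilinear K -> multilinear L ->
  has_degree p K -> has_degree q L -> has_degree (p + q) (insertion K L).
Proof.
move=> mK mL dK dL; apply/has_degreeP => d X hX.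
rewrite (insertion_homogE mK mL erefl hX).
have [sdX hXi] := (homog_seqP _ _).1 hX.
rewrite (big_nth 0) big_mkord sdX.
by apply: insertion_homog_degree => // i; apply: hXi.
Qed.

Lemma insertion_homog_combl a K K' L n (d : 'I_n -> int) x : multilinear L ->
  insertion_homog (a *: K + K') L d x
  = a *: insertion_homog K L d x + insertion_homog K' L d x.
Proof.
move=> mL; rewrite /insertion_homog scaler_sumr -big_split.
apply: eq_bigr => k _; rewrite scaler_sumr -big_split.
apply: eq_bigr => s _; rewrite /= scalerA mulrC -scalerA -scalerDr.
by congr (_ *: _); exact: (mL [::]).
Qed.

Lemma insertion_homog_combr a K L L' n (d : 'I_n -> int) x :
  insertion_homog K (a *: L + L') d x
  = a *: insertion_homog K L d x + insertion_homog K L' d x.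
Proof.
rewrite /insertion_homog scaler_sumr -big_split.
apply: eq_bigr => k _; rewrite scaler_sumr -big_split.
by apply: eq_bigr => s _; rewrite /= scalerA mulrC -scalerA -scalerDr.
Qed.

(** The Koszul sign of exchanging two neighbours of degrees a and b. *)
Definition ksign (a b : int) : F := (-1) ^ (a * b).

Lemma ksignC a b : ksign a b = ksign b a.
Proof. by rewrite /ksign mulrC. Qed.

(** * Insertions with at most three arguments *)

Lemma insertion_homog1 K L (a : int) (x : E) :
  insertion_homog K L (fun i : 'I_1 => [:: a]`_i) (fun i : 'I_1 => [:: x]`_i)
  = L [:: K [::]; x] + L [:: K [:: x]].
Proof.
rewrite /insertion_homog /koszul_sign /unshuffle.
rewrite !big_ord_recl big_ord0 /=.
do !rewrite ?big_mkcond ?big_lift_perm ?big_perm0 /= ?big_ord_recl ?big_ord0 /=.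
rewrite !forall_ordS !forall_ord0 !enum_ordSl !enum_ord0 /=.
rewrite !lift_perm_id /=.
by rewrite !mulr1 !scale1r !addr0.
Qed.

Lemma insertion_homog2 K L (a b : int) (x y : E) :
  insertion_homog K L (fun i : 'I_2 => [:: a; b]`_i) (fun i : 'I_2 => [:: x; y]`_i)
  = L [:: K [::]; x; y] + (L [:: K [:: x]; y] + ksign a b *: L [:: K [:: y]; x])
    + L [:: K [:: x; y]].
Proof.
rewrite /insertion_homog /koszul_sign /unshuffle.
rewrite !big_ord_recl big_ord0 /=.
do !rewrite ?big_mkcond ?big_lift_perm ?big_perm0 /= ?big_ord_recl ?big_ord0 /=.
rewrite !forall_ordS !forall_ord0 !enum_ordSl !enum_ord0 /=.
rewrite !lift_perm_id /= ?lift_perm_lift ?lift_perm_id ?perm1 /=.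
rewrite !(mulr1, mul1r) !scale1r !addr0 ?addrA.
by rewrite [b * a]mulrC.
Qed.

(** One factor for each of the three pairs of positions. *)
Lemma koszul_sign3 (d : 'I_3 -> int) (s : 'S_3) :
  let i0 := s ord0 in let i1 := s (lift ord0 ord0) in
  let i2 := s (lift ord0 (lift ord0 ord0)) in
  koszul_sign F d s = (if (i1 < i0)%N then ksign (d i0) (d i1) else 1)
    * (if (i2 < i0)%N then ksign (d i0) (d i2) else 1)
    * (if (i2 < i1)%N then ksign (d i1) (d i2) else 1).
Proof.
rewrite /koszul_sign /ksign !big_ord_recl !big_ord0 /=.
rewrite 3!(big_mkcond (fun j : 'I_3 => _ && _)) !big_ord_recl !big_ord0 /=.
by rewrite !(mulr1, mul1r) ?mulrA.
Qed.

(** One summand for each of the unshuffles of types (0,3), (1,2), (2,1) and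
    (3,0). *)
Lemma insertion_homog3 K L (a b c : int) (x y z : E) :
  insertion_homog K L (fun i : 'I_3 => [:: a; b; c]`_i) (fun i : 'I_3 => [:: x; y; z]`_i)
  = L [:: K [::]; x; y; z]
    + (L [:: K [:: x]; y; z] + ksign a b *: L [:: K [:: y]; x; z]
       + (ksign a c * ksign b c) *: L [:: K [:: z]; x; y])
    + (L [:: K [:: x; y]; z] + ksign b c *: L [:: K [:: x; z]; y]
       + (ksign a b * ksign a c) *: L [:: K [:: y; z]; x])
    + L [:: K [:: x; y; z]].
Proof.
rewrite /insertion_homog !big_ord_recl big_ord0 !enum_ordSl !enum_ord0 /=.
rewrite !big_perm3 !big_ord_recl !big_ord0.
rewrite !unshuffle3 !(lift_perm_id, lift_perm_lift) /=.
rewrite !(addr0, add0r) !koszul_sign3 !(lift_perm_id, lift_perm_lift) /=.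
rewrite !(mulr1, mul1r) !scale1r.
by rewrite (ksignC b a) (ksignC c a) (ksignC c b) !addrA.
Qed.

Lemma ksignK a b : ksign a b * ksign a b = 1.
Proof. by rewrite /ksign -expfzMl mulrNN mulr1 exp1rz. Qed.

Lemma ksignK_scale a b (x : E) : ksign a b *: (ksign a b *: x) = x.
Proof. by rewrite scalerA ksignK scale1r. Qed.

Lemma insertion0 K L : multilinear K -> multilinear L ->
  insertion K L [::] = L [:: K [::]].
Proof.
move=> mK mL; rewrite (@insertion_homogE K L 0 [::] [::]) //.
rewrite /insertion_homog /unshuffle /koszul_sign big_ord_recl big_ord0 big_mkcond big_perm0.
by rewrite forall_ord0 big_ord0 enum_ord0 scale1r addr0.
Qed.

Lemma insertion1 K L a x : multilinear K -> multilinear L -> homog a x ->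
  insertion K L [:: x] = L [:: K [::]; x] + L [:: K [:: x]].
Proof.
move=> mK mL hx; rewrite (@insertion_homogE K L 1 [:: a] [:: x]) //=.
exact: insertion_homog1.
Qed.

Lemma insertion2 K L a b x y : multilinear K -> multilinear L ->
  homog a x -> homog b y ->
  insertion K L [:: x; y] =
    L [:: K [::]; x; y] + (L [:: K [:: x]; y] + ksign a b *: L [:: K [:: y]; x])
    + L [:: K [:: x; y]].
Proof.
move=> mK mL hx hy; rewrite (@insertion_homogE K L 2 [:: a; b] [:: x; y]) //=.
exact: insertion_homog2.
Qed.

Lemma insertion3 K L a b c x y z : multilinear K -> multilinear L ->
  homog a x -> homog b y -> homog c z ->
  insertion K L [:: x; y; z] =
    L [:: K [::]; x; y; z]
    + (L [:: K [:: x]; y; z] + ksign a b *: L [:: K [:: y]; x; z]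
       + (ksign a c * ksign b c) *: L [:: K [:: z]; x; y])
    + (L [:: K [:: x; y]; z] + ksign b c *: L [:: K [:: x; z]; y]
       + (ksign a b * ksign a c) *: L [:: K [:: y; z]; x])
    + L [:: K [:: x; y; z]].
Proof.
move=> mK mL hx hy hz.
rewrite (@insertion_homogE K L 3 [:: a; b; c] [:: x; y; z]) //=.
exact: insertion_homog3.
Qed.

(** Exchanging two neighbours permutes the unshuffle terms of an insertion, up to
    the symmetry of K and L themselves. *)
Section SmallArity.
Variables (K L : vvform E).
Hypotheses (mK : multilinear K) (sK : graded_symmetric K).
Hypotheses (mL : multilinear L) (sL : graded_symmetric L).

Lemma insertion_swap2 a b x y : homog a x -> homog b y ->
  insertion K L [:: y; x] = ksign a b *: insertion K L [:: x; y].
Proof.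
move=> hx hy; rewrite (insertion2 mK mL hx hy) (insertion2 mK mL hy hx).
rewrite (sL [:: _] [::] hx hy) (sK [::] [::] hx hy) multilinearZ_head // -/(ksign a b).
rewrite (ksignC b a) !scalerDr ksignK_scale.
by congr (_ + _ + _); rewrite addrC.
Qed.

Lemma insertion_swap3l a b c x y z : homog a x -> homog b y -> homog c z ->
  insertion K L [:: y; x; z] = ksign a b *: insertion K L [:: x; y; z].
Proof.
move=> hx hy hz; rewrite (insertion3 mK mL hx hy hz) (insertion3 mK mL hy hx hz).
rewrite (sL [:: _] [:: z] hx hy) (sL [:: _] [::] hx hy).
rewrite (sK [::] [::] hx hy) (sK [::] [:: z] hx hy) !multilinearZ_head // -/(ksign a b).
rewrite (ksignC b a) !scalerDr ksignK_scale !scalerA.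
congr (_ + _ + _ + _).
  congr (_ + _); first by rewrite addrC.
  by congr (_ *: _); ring.
rewrite -!addrA; congr (_ + _); rewrite addrC; congr (_ + _).
by rewrite mulrA ksignK mul1r.
Qed.

Lemma insertion_swap3r a b c x y z : homog a x -> homog b y -> homog c z ->
  insertion K L [:: x; z; y] = ksign b c *: insertion K L [:: x; y; z].
Proof.
move=> hx hy hz; rewrite (insertion3 mK mL hx hy hz) (insertion3 mK mL hx hz hy).
rewrite (sL [:: _; _] [::] hy hz) (sL [:: _] [::] hy hz).
rewrite (sK [:: _] [::] hy hz) (sK [::] [::] hy hz) !multilinearZ_head // -/(ksign b c).
rewrite (ksignC c b) !scalerDr ksignK_scale !scalerA.
congr (_ + _ + _ + _).
  rewrite -!addrA; congr (_ + _); rewrite addrC; congr (_ *: _ + _ *: _).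
    by ring.
  by rewrite mulrCA ksignK mulr1.
rewrite [X in X + _ = _]addrC; congr (_ + _).
by congr (_ *: _); ring.
Qed.

End SmallArity.

(** * Forms on a space concentrated in degrees -2 and -1 *)

Section Concentrated.
Hypothesis hE : concentrated E [:: - 2; - 1].

Lemma gproj_out i (x : E) : i \notin [:: -2; -1] -> gproj E i x = 0.
Proof. exact/hE/homog_gproj. Qed.

Lemma gproj_sum2 (x : E) : x = gproj E (-2) x + gproj E (-1) x.
Proof.
rewrite {1}(gproj_sum x) (fsbigE [:: -2; -1]) //=; last first.
  by move=> i _; exact: gproj_out.
by rewrite !big_cons big_nil !mem_setT addr0.
Qed.

Lemma homog_le_eq0 (i : int) (x : E) : i <= -3 -> homog i x -> x = 0.
Proof. by move=> ile hx; apply: (hE hx); rewrite !inE; lia. Qed.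

Lemma homog_ge_eq0 (i : int) (x : E) : 0 <= i -> homog i x -> x = 0.
Proof. by move=> ige hx; apply: (hE hx); rewrite !inE; lia. Qed.

(** Each argument is the sum of its components of degrees -2 and -1, so an
    additive property has to be checked on homogeneous arguments only. *)
Lemma homog_seq_ind (P : seq E -> Prop) :
  (forall U V x y, P (U ++ x :: V) -> P (U ++ y :: V) -> P (U ++ (x + y) :: V)) ->
  (forall (d : seq int) X, all (<= -1) d -> homog_seq d X -> P X) ->
  forall X, P X.
Proof.
move=> PD Phomog X.
suff: forall (d : seq int) U, all (<= -1) d -> homog_seq d U -> P (U ++ X).
  by move=> /(_ [::] [::]); exact.
elim: X => [|x X IHX] d U hd hU; first by rewrite cats0; exact: Phomog hU.
have Pproj i : i <= -1 -> P (U ++ gproj E i x :: X).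
  move=> hi; rewrite -cat_rcons; apply: (IHX (rcons d i)); first by rewrite all_rcons /= hi.
  by rewrite -!cats1; apply: homog_seq_cat => //=; split=> //; exact: homog_gproj.
by rewrite [x]gproj_sum2; apply: PD; exact: Pproj.
Qed.

Lemma multilinear_ext K L : multilinear K -> multilinear L ->
  (forall (d : seq int) X, all (<= -1) d -> homog_seq d X -> K X = L X) -> K = L.
Proof.
move=> mK mL eKL; apply/funext; apply: homog_seq_ind => // U V x y eUxV eUyV.
by rewrite !multilinearD // eUxV eUyV.
Qed.

(** Four or more arguments of negative degree have total degree at most -4, so
    the value has degree at most -3. *)
Lemma has_degree_eq0 (q : int) K (d : seq int) X : q <= 1 -> has_degree q K ->
  all (<= -1) d -> homog_seq d X -> (3 < size X)%N -> K X = 0.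
Proof.
move=> q1 /has_degreeP dK hd hX; have [<- _] := (homog_seqP _ _).1 hX => sd.
apply: homog_le_eq0 (dK _ _ hX).
have : \sum_(e <- d) e <= - (size d)%:Z.
  elim: d hd {hX sd} => [|e d IHd] /=; first by rewrite big_nil.
  move=> /andP[he /IHd h]; rewrite big_cons.
  rewrite (_ : - _ = -1 + - (size d)%:Z); [exact: lerD | lia].
move: (\sum_(e <- d) e) => t; lia.
Qed.

(** The exchanged arguments are homogeneous already; the ones around them are
    reduced to homogeneous ones by additivity, on either side in turn. *)
Lemma graded_symmetric_homog K : multilinear K ->
  (forall (dU dV : seq int) (p q : int) U V x y, all (<= -1) (dU ++ p :: q :: dV) ->
     homog_seq dU U -> homog_seq dV V -> homog p x -> homog q y ->
     K (U ++ y :: x :: V) = ksign p q *: K (U ++ x :: y :: V)) ->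
  graded_symmetric K.
Proof.
move=> mK sK U V p q x y hx hy.
have [p0|hp] := lerP 0 p.
  rewrite (homog_ge_eq0 p0 hx) -cat_rcons.
  by rewrite !multilinear0 // scaler0.
have [q0|hq] := lerP 0 q.
  rewrite (homog_ge_eq0 q0 hy) -[in RHS]cat_rcons.
  by rewrite !multilinear0 // scaler0.
move: U V; apply: homog_seq_ind => [U1 U2 u v hu hv|dU U hdU hU] V.
  move: (hu V) (hv V); rewrite -!catA !cat_cons !multilinearD // => -> ->.
  by rewrite scalerDr.
move: V; apply: homog_seq_ind => [V1 V2 u v hu hv|dV V hdV hV].
  have cat3 a b w W : U ++ a :: b :: V1 ++ w :: W = (U ++ a :: b :: V1) ++ w :: W.
    by rewrite -catA.
  by move: hu hv; rewrite !cat3 !multilinearD // => -> ->; rewrite scalerDr.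
apply: (sK dU dV) => //.
rewrite all_cat hdU /= hdV; lia.
Qed.

(** Only degrees -2 and -1 contribute, which makes the sum over degree
    assignments finite, uniformly in the arguments. *)
Lemma insertion_fin K L n X : multilinear K -> multilinear L -> size X = n ->
  let deg (b : bool) : int := if b then -1 else -2 in
  insertion K L X = \sum_(b : {ffun 'I_n -> bool})
    insertion_homog K L (fun i => deg (b i)) (fun i => gproj E (deg (b i)) X`_i).
Proof.
move=> mK mL <- deg; rewrite /insertion.
pose h (b : {ffun 'I_(size X) -> bool}) : {ffun 'I_(size X) -> int} := [ffun i => deg (b i)].
have injh : injective h.
  move=> b c /ffunP bc; apply/ffunP => i; have := bc i; rewrite !ffunE.
  by case: (b i); case: (c i).
rewrite (fsbigE (codom h)) //=; first last.
- move=> d _ dh.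
  have [i di] : exists i, d i \notin [:: -2; -1].
    apply/existsP; rewrite -negb_forall; apply: contra dh => /forallP hd.
    apply/codomP; exists [ffun i => d i == -1]; apply/ffunP => i; rewrite !ffunE.
    by have := hd i; rewrite !inE => /orP[]/eqP ->.
  by apply: (@insertion_homog0 _ _ _ _ _ i) => //; exact: gproj_out.
- by rewrite codomE map_inj_uniq // enum_uniq.
rewrite codomE big_map big_enum_cond /=.
rewrite (eq_bigl xpredT) => [|b]; last by rewrite mem_setT.
apply: eq_bigr => b _.
by congr insertion_homog; apply/funext => i; rewrite ffunE.
Qed.

Lemma insertion_multilinear K L :
  multilinear K -> multilinear L -> multilinear (insertion K L).
Proof.
move=> mK mL U V a x y; pose n := size (U ++ x :: V).
have sz z : size (U ++ z :: V) = n by rewrite /n !size_cat.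
have ltUn : (size U < n)%N by rewrite /n size_cat /= -addSnnS leq_addr.
pose j := Ordinal ltUn.
rewrite !(insertion_fin mK mL (sz _)) scaler_sumr -big_split; apply: eq_bigr => b _.
have nthj z : (U ++ z :: V)`_j = z by rewrite nth_cat ltnn subnn.
have nthi z i : i != j -> (U ++ z :: V)`_i = (U ++ x :: V)`_i.
  move=> ij; rewrite !nth_cat; case: ltnP => // Ui.
  rewrite -[(i - size U)%N]prednK //= subn_gt0 ltn_neqAle Ui andbT.
  by apply: contraNneq ij => Ui'; apply/eqP/val_inj.
apply: (@insertion_homog_multilinear _ _ _ _ _ _ _ a j) => //.
- by rewrite !nthj linearP.
- by move=> i ij; rewrite nthi.
- by move=> i ij; rewrite nthi.
Qed.

Lemma insertion_combl a K K' L : multilinear K -> multilinear K' -> multilinear L ->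
  insertion (a *: K + K') L = a *: insertion K L + insertion K' L.
Proof.
move=> mK mK' mL; apply: multilinear_ext => [||d X _ hX].
- by apply: insertion_multilinear => //; exact: multilinear_comb.
- by apply: multilinear_comb; exact: insertion_multilinear.
have mKK' := multilinear_comb a mK mK'.
by rewrite !vvformE !(insertion_homogE _ _ erefl hX) // insertion_homog_combl.
Qed.

Lemma insertion_combr a K L L' : multilinear K -> multilinear L -> multilinear L' ->
  insertion K (a *: L + L') = a *: insertion K L + insertion K L'.
Proof.
move=> mK mL mL'; apply: multilinear_ext => [||d X _ hX].
- by apply: insertion_multilinear => //; exact: multilinear_comb.
- by apply: multilinear_comb; exact: insertion_multilinear.
have mLL' := multilinear_comb a mL mL'.
by rewrite !vvformE !(insertion_homogE _ _ erefl hX) // insertion_homog_combr.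
Qed.

(** The bound on the degree lets insertions with four or more arguments vanish,
    and leaves the three exchanges possible among at most three arguments. *)
Lemma insertion_symmetric K L (p q : int) : p + q <= 1 ->
  symmetric_form p K -> symmetric_form q L -> symmetric_form (p + q) (insertion K L).
Proof.
move=> pq1 [mK sK dK] [mL sL dL].
have mKL := insertion_multilinear mK mL.
have dKL := insertion_degree mK mL dK dL.
split=> //; apply: graded_symmetric_homog => //.
move=> dU dV a b U V x y hd hU hV hx hy.
have [big|] := ltnP 3 (size (U ++ x :: y :: V)).
  have hswap : homog_seq (dU ++ b :: a :: dV) (U ++ y :: x :: V).
    by apply: homog_seq_cat => //; split.
  have hstraight : homog_seq (dU ++ a :: b :: dV) (U ++ x :: y :: V).
    by apply: homog_seq_cat => //; split.
  rewrite (has_degree_eq0 pq1 dKL hd hstraight) // scaler0.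
  apply: (has_degree_eq0 pq1 dKL _ hswap).
    by move: hd; rewrite !all_cat /= [X in _ && X]andbCA.
  by move: big; rewrite !size_cat.
case: U dU hU {hd} => [|u [|u' U]] [|du [|du' dU]] //=; try by move=> -[_ []].
- move=> _; case: V dV hV => [|v [|v' V]] [|dv [|dv' dV]] //=; try by move=> -[_ []].
  + by move=> _ _; exact: insertion_swap2.
  + by move=> [hv _] _; exact: insertion_swap3l hx hy hv.
- move=> [hu _]; case: V dV hV => [|v V] [|dv dV] //= _ _.
  exact: insertion_swap3r hu hx hy.
- by rewrite size_cat /= !addnS.
Qed.

(** * The bracket *)

Lemma rn_bracket_symmetric K L (p q : int) : p + q <= 1 ->
  symmetric_form p K -> symmetric_form q L -> symmetric_form (p + q) (rn_bracket p q K L).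
Proof.
move=> pq hK hL; rewrite /rn_bracket [X in symmetric_form _ X]addrC -scaleNr.
apply: symmetric_form_comb.
  by rewrite addrC; apply: insertion_symmetric; rewrite // addrC.
exact: insertion_symmetric.
Qed.

Lemma rn_bracket_combl p q a K K' L : multilinear K -> multilinear K' -> multilinear L ->
  rn_bracket p q (a *: K + K') L = a *: rn_bracket p q K L + rn_bracket p q K' L.
Proof.
move=> mK mK' mL; rewrite /rn_bracket insertion_combl // insertion_combr //.
by rewrite !scalerDr !scalerN !scalerA [_ * a]mulrC opprD addrACA.
Qed.

Lemma rn_bracket_combr p q a K L L' : multilinear K -> multilinear L -> multilinear L' ->
  rn_bracket p q K (a *: L + L') = a *: rn_bracket p q K L + rn_bracket p q K L'.
Proof.
move=> mK mL mL'; rewrite /rn_bracket insertion_combl // insertion_combr //.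
by rewrite !scalerDr !scalerN !scalerA [_ * a]mulrC opprD addrACA.
Qed.

Lemma rn_bracketDl p q K K' L : multilinear K -> multilinear K' -> multilinear L ->
  rn_bracket p q (K + K') L = rn_bracket p q K L + rn_bracket p q K' L.
Proof. by move=> *; rewrite -[K]scale1r rn_bracket_combl // !scale1r. Qed.

Lemma rn_bracketDr p q K L L' : multilinear K -> multilinear L -> multilinear L' ->
  rn_bracket p q K (L + L') = rn_bracket p q K L + rn_bracket p q K L'.
Proof. by move=> *; rewrite -[L]scale1r rn_bracket_combr // !scale1r. Qed.

Lemma rn_bracket0 q K L : rn_bracket 0 q K L = insertion K L - insertion L K.
Proof. by rewrite /rn_bracket mul0r expr0z scale1r. Qed.

(** * The Euler map *)

Lemma eulerE (x : E) : euler E [:: x] = 2 *: gproj E (-2) x + gproj E (-1) x.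
Proof.
rewrite /= (fsbigE [:: -2; -1]) //=; last first.
  by move=> i _ h; rewrite gproj_out // scaler0.
by rewrite !big_cons big_nil !mem_setT addr0 scale1r.
Qed.

Lemma euler_homog a (x : E) : homog a x -> euler E [:: x] = (- a)%:~R *: x.
Proof.
move=> hx; rewrite /= (fsbigE [:: a]) //=; last first.
  by move=> i _; rewrite inE (gproj_homog _ hx) => /negPf ->; rewrite scaler0.
by rewrite big_cons big_nil mem_setT addr0 hx.
Qed.

Lemma euler_symmetric : symmetric_form 0 (euler E).
Proof.
split.
- move=> [|u [|u' U]] [|v V] a x y; try by rewrite /= scaler0 addr0.
  rewrite [LHS]eulerE !eulerE !(linearP (gproj E _)) !scalerDr !scalerA [2 * a]mulrC.
  by rewrite addrACA.
- by move=> [|u [|u' U]] V p q x y _ _; rewrite /= scaler0.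
- apply/has_degreeP => -[|a [|b d]] [|x [|y X]] //=; try by move=> -[_ []].
  + by move=> _; exact: homog0.
  + move=> [hx _]; have /= -> := euler_homog hx.
    by rewrite big_seq1 addr0; exact: homogZ.
  + by move=> _; exact: homog0.
Qed.

(** Here iota_S L multiplies L by minus the total degree of the arguments, since
    the Koszul sign of moving an argument to the front is undone by the symmetry
    of L; iota_L S multiplies it by minus the degree of the value. *)
Lemma rn_bracket_euler (q : int) L : q <= 1 -> symmetric_form q L ->
  rn_bracket 0 q (euler E) L = q%:~R *: L.
Proof.
move=> q1 hL; have [mL sL dL] := hL; have [mS sS dS] := euler_symmetric.
have hb : symmetric_form q (rn_bracket 0 q (euler E) L).
  by have := @rn_bracket_symmetric _ _ 0 q _ euler_symmetric hL; rewrite add0r; exact.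
apply: multilinear_ext => //; first by case: hb.
  by move=> U V a x y; rewrite !vvformE mL scalerDr !scalerA mulrC.
move=> d X hd hX; rewrite !vvformE.
have [big|] := ltnP 3 (size X).
  rewrite (has_degree_eq0 q1 _ hd hX) //; last by case: hb.
  by rewrite (has_degree_eq0 q1 dL hd hX) // scaler0.
have dLX := (has_degreeP _ _).1 dL _ _ hX.
have S0 : euler E [::] = 0 by [].
have S2 u v V : euler E (u :: v :: V) = 0 by [].
move: hX dLX; rewrite rn_bracket0 vvformE.
case: X d {hd} => [|x [|y [|z [|? ?]]]] [|a [|b [|c [|? ?]]]] //=; try by intuition.
- move=> _; rewrite big_nil add0r => hLX _.
  rewrite !insertion0 // S0 multilinear0_head // sub0r (euler_homog hLX).
  by rewrite -scaleNr intrN opprK.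
- move=> [hx _]; rewrite big_seq1 => hLX _.
  rewrite !(insertion1 _ _ hx) // S0 S2 multilinear0_head // !add0r.
  rewrite (euler_homog hx) (euler_homog hLX) multilinearZ_head //.
  by rewrite -scalerBl -intrB; congr (_%:~R *: _); ring.
- move=> [hx [hy _]]; rewrite !big_cons big_nil => hLX _.
  rewrite !(insertion2 _ _ hx hy) // S0 !S2 !multilinear0_head // scaler0 !(add0r, addr0).
  rewrite (euler_homog hx) (euler_homog hy) (euler_homog hLX) !multilinearZ_head //.
  rewrite (sL [::] [::] _ _ _ _ hx hy) -/(ksign a b) scalerA mulrC -scalerA ksignK_scale.
  by rewrite -scalerDl -scalerBl -intrD -intrB; congr (_%:~R *: _); ring.
- move=> [hx [hy [hz _]]]; rewrite !big_cons big_nil => hLX _.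
  rewrite !(insertion3 _ _ hx hy hz) // S0 !S2 !multilinear0_head //.
  rewrite !scaler0 !(add0r, addr0).
  rewrite (euler_homog hx) (euler_homog hy) (euler_homog hz) (euler_homog hLX).
  rewrite !multilinearZ_head //.
  rewrite (sL [::] [:: y] _ _ _ _ hx hz) (sL [::] [:: z] _ _ _ _ hx hy) /=.
  rewrite (sL [:: x] [::] _ _ _ _ hy hz) -/(ksign a b) -/(ksign b c) -/(ksign a c).
  rewrite !(scalerA, mulrA) -!scalerDl -scalerBl; congr (_ *: _).
  have -> : ksign a b * (- b)%:~R * ksign a b = (- b)%:~R :> F.
    by rewrite mulrAC ksignK mul1r.
  have -> : ksign a c * ksign b c * (- c)%:~R * ksign a c * ksign b c = (- c)%:~R :> F.
    transitivity ((ksign a c * ksign a c) * (ksign b c * ksign b c) * (- c)%:~R).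
      by ring.
    by rewrite !ksignK !mul1r.
  by rewrite -!intrD -intrB; congr (_%:~R); ring.
Qed.

(** * The double bracket with a 2-form of degree 0 *)

Section DoubleBracket.
Variables (mu alpha : vvform E).
Hypotheses (mu0 : mu [::] = 0) (hmu : symmetric_form 1 mu).
Hypothesis (halpha : symmetric_kform 2 0 alpha).
Let beta := rn_bracket 0 1 alpha mu.

Let alpha_ar : has_arity 2 alpha := halpha.1.
Let ha : symmetric_form 0 alpha := halpha.2.
Let mm : multilinear mu. Proof. by case: hmu. Qed.
Let ma : multilinear alpha. Proof. by case: ha. Qed.

Lemma single_bracket_symmetric : symmetric_form 1 beta.
Proof. exact: (@rn_bracket_symmetric _ _ 0 1). Qed.

Let mb : multilinear beta. Proof. by case: single_bracket_symmetric. Qed.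

Let gamma := rn_bracket 0 1 alpha beta.

Lemma double_bracket_symmetric : symmetric_form 1 gamma.
Proof. exact: (@rn_bracket_symmetric _ _ 0 1 _ ha single_bracket_symmetric). Qed.

Lemma single_bracket0 : beta [::] = 0.
Proof.
rewrite /beta rn_bracket0 vvformE !insertion0 //.
by rewrite (alpha_ar (X := [::])) // (alpha_ar (X := [:: _])) // multilinear0_head // subr0.
Qed.

Lemma single_bracket1 a x : homog a x -> beta [:: x] = 0.
Proof.
move=> hx; rewrite /beta rn_bracket0 vvformE !(insertion1 _ _ hx) //.
rewrite mu0 (alpha_ar (X := [::])) // !(alpha_ar (X := [:: _])) // !multilinear0_head //.
by rewrite !addr0 subr0.
Qed.

Lemma single_bracket2 a b x y : homog a x -> homog b y ->
  beta [:: x; y] = mu [:: alpha [:: x; y]]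
    - (alpha [:: mu [:: x]; y] + ksign a b *: alpha [:: mu [:: y]; x]).
Proof.
move=> hx hy; rewrite /beta rn_bracket0 vvformE !(insertion2 _ _ hx hy) //.
rewrite mu0 (alpha_ar (X := [::])) // (alpha_ar (X := [:: x])) //.
rewrite (alpha_ar (X := [:: y])) // !multilinear0_head //.
by rewrite (alpha_ar (X := [:: _])) // scaler0 !(addr0, add0r).
Qed.

Lemma alpha_homog a b x y : homog a x -> homog b y -> homog (a + b) (alpha [:: x; y]).
Proof.
case: ha => _ _ /has_degreeP da hx hy.
by have := da [:: a; b] [:: x; y]; rewrite !big_cons big_nil !addr0; apply.
Qed.

Lemma mu_homog a x : homog a x -> homog (a + 1) (mu [:: x]).
Proof.
by case: hmu => _ _ /has_degreeP dm hx; have := dm [:: a] [:: x]; rewrite big_seq1; apply.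
Qed.

(** Each of the two insertions contributes the cyclic sum once, with sign -1.
    For u = alpha(X, Y) of degree -2, the value of [alpha, mu] at (u, Z) is
    -alpha(mu u, Z), as alpha(u, Z) has degree -3 and mu Z degree 0; its value at
    (X, Y) is mu u.  The cyclic order results from alpha(X, Z) = -alpha(Z, X). *)
Lemma double_bracket3 x y z : homog (-1) x -> homog (-1) y -> homog (-1) z ->
  gamma [:: x; y; z] = - 2 *: (alpha [:: mu [:: alpha [:: x; y]]; z]
    + alpha [:: mu [:: alpha [:: y; z]]; x] + alpha [:: mu [:: alpha [:: z; x]]; y]).
Proof.
move=> hx hy hz; have [_ sa _] := ha.
have ksign11 : ksign (-1) (-1) = -1 by rewrite /ksign mulrNN mulr1 expr1z.
have mu1 u : homog (-1) u -> mu [:: u] = 0 by move=> /mu_homog/homog_ge_eq0; exact.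
have beta11 u v : homog (-1) u -> homog (-1) v -> beta [:: u; v] = mu [:: alpha [:: u; v]].
  move=> hu hv; rewrite (single_bracket2 hu hv) (mu1 u) // (mu1 v) //.
  by rewrite !multilinear0_head // scaler0 addr0 subr0.
have beta21 u v w : homog (-1) u -> homog (-1) v -> homog (-1) w ->
    beta [:: alpha [:: u; v]; w] = - alpha [:: mu [:: alpha [:: u; v]]; w].
  move=> hu hv hw; have huv := alpha_homog hu hv.
  rewrite (single_bracket2 huv hw) (mu1 w) // multilinear0_head // scaler0 addr0.
  by rewrite (homog_le_eq0 _ (alpha_homog huv hw)) // multilinear0_head // sub0r.
rewrite /gamma rn_bracket0 vvformE !(insertion3 _ _ hx hy hz) //.
rewrite single_bracket0 !(alpha_ar (X := [::])) // !(alpha_ar (X := [:: _])) //.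
rewrite !(alpha_ar (X := [:: _, _, _ & _])) //.
rewrite !multilinear0_head // !scaler0 !(addr0, add0r) !beta21 // !beta11 // ksign11.
rewrite mulrNN mulr1 !scale1r.
have -> : alpha [:: x; z] = - alpha [:: z; x].
  by rewrite (sa [::] [::] _ _ _ _ hz hx) -/(ksign (-1) (-1)) ksign11 scaleN1r.
rewrite !multilinearN_head // !scaleN1r !opprK.
set A := alpha [:: _; z]; set B := alpha [:: _; x]; set C := alpha [:: _; y].
by rewrite -!opprD (addrAC A C) scaleNr scaler_nat mulr2n.
Qed.

(** By degree, three arguments not all in E_{-1} give the value 0 as well. *)
Lemma double_bracket_eq0 : (2 : F) != 0 ->
  gamma = 0 <->
  (forall X Y Z, homog (-1) X -> homog (-1) Y -> homog (-1) Z ->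
     alpha [:: mu [:: alpha [:: X; Y]]; Z] + alpha [:: mu [:: alpha [:: Y; Z]]; X]
     + alpha [:: mu [:: alpha [:: Z; X]]; Y] = 0).
Proof.
move=> two0; split=> [g0 X Y Z hX hY hZ|cyc0].
  have := double_bracket3 hX hY hZ; rewrite g0 => /esym/eqP.
  by rewrite scaler_eq0 oppr_eq0 (negPf two0) => /eqP.
have [mg _ dg] := double_bracket_symmetric.
apply: multilinear_ext => // [U V a x y|d X hd hX]; first by rewrite scaler0 addr0.
have [big|] := ltnP 3 (size X); first exact: (has_degree_eq0 _ dg hd hX).
have hgX := (has_degreeP _ _).1 dg _ _ hX.
rewrite !vvformE.
case: X d hX hd hgX => [|x [|y [|z [|? ?]]]] [|a [|b [|c [|? ?]]]] //=; try by intuition.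
- move=> _ _ _ _; rewrite /gamma rn_bracket0 vvformE !insertion0 //.
  by rewrite (alpha_ar (X := [::])) // (alpha_ar (X := [:: _])) // multilinear0_head // subr0.
- move=> [hx _] _ _ _; rewrite /gamma rn_bracket0 vvformE !(insertion1 _ _ hx) //.
  rewrite single_bracket0 (alpha_ar (X := [::])) // !(alpha_ar (X := [:: _])) //.
  by rewrite !multilinear0_head // !addr0 subr0.
- move=> [hx [hy _]] _ _ _; rewrite /gamma rn_bracket0 vvformE !(insertion2 _ _ hx hy) //.
  rewrite single_bracket0 (single_bracket1 hx) (single_bracket1 hy).
  rewrite (single_bracket1 (alpha_homog hx hy)).
  rewrite (alpha_ar (X := [::])) // !(alpha_ar (X := [:: _])) // !multilinear0_head //.
  by rewrite scaler0 !addr0 subr0.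
- move=> [hx [hy [hz _]]] /and4P[ha1 hb1 hc1 _]; rewrite !big_cons big_nil => hg _.
  have [abc|abc] := boolP [&& a == -1, b == -1 & c == -1].
    case/and3P: abc hx hy hz => /eqP -> /eqP -> /eqP -> hx hy hz.
    by rewrite double_bracket3 // cyc0 // scaler0.
  by apply: homog_le_eq0 hg => //; lia.
Qed.

(** * Nijenhuis forms *)

Lemma Nijenhuis_double_bracket :
  Nijenhuis_with_square mu (euler E + alpha) (euler E + 2 *: alpha) <-> gamma = 0.
Proof.
have hS := euler_symmetric; have [mS _ _] := hS.
have hN : symmetric_form 0 (euler E + alpha).
  by rewrite -[euler E]scale1r; exact: symmetric_form_comb.
have hK : symmetric_form 0 (euler E + 2 *: alpha).
  by rewrite addrC; exact: symmetric_form_comb.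
have m2a : multilinear (2 *: alpha).
  by rewrite -[_ *: _]addr0; apply: multilinear_comb => // U V a x y; rewrite scaler0 addr0.
have rn_a2 q L : multilinear L -> rn_bracket 0 q (2 *: alpha) L = 2 *: rn_bracket 0 q alpha L.
  move=> mL; rewrite scaler_nat mulr2n rn_bracketDl //.
  by rewrite -mulr2n -scaler_nat.
have NN : rn_bracket 0 1 (euler E + alpha) (rn_bracket 0 1 (euler E + alpha) mu)
    = mu + 2 *: beta + gamma.
  rewrite [X in rn_bracket 0 1 _ X]rn_bracketDl // (rn_bracket_euler _ hmu) // scale1r.
  rewrite rn_bracketDr //; last by case: hN.
  rewrite !rn_bracketDl // (rn_bracket_euler _ hmu) //.
  rewrite (rn_bracket_euler _ single_bracket_symmetric) //.
  by rewrite !scale1r scaler_nat mulr2n -/beta -/gamma !addrA.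
have KK : rn_bracket 0 1 (euler E + 2 *: alpha) mu = mu + 2 *: beta.
  by rewrite rn_bracketDl // (rn_bracket_euler _ hmu) // scale1r rn_a2.
have NK : rn_bracket 0 0 (euler E + alpha) (euler E + 2 *: alpha) = 0.
  have SL L : symmetric_form 0 L -> rn_bracket 0 0 (euler E) L = 0.
    by move=> hL; rewrite rn_bracket_euler // mulr0z scale0r.
  have aS : rn_bracket 0 0 alpha (euler E) = 0.
    by rewrite -[LHS]opprK rn_bracket0 opprB -(rn_bracket0 0) SL // oppr0.
  have Sa : rn_bracket 0 0 (euler E) (2 *: alpha) = 0.
    rewrite scaler_nat mulr2n rn_bracketDr // SL //.
    exact: addr0.
  have aa2 : rn_bracket 0 0 alpha (2 *: alpha) = 0.
    by rewrite scaler_nat mulr2n rn_bracketDr // rn_bracket0 subrr addr0.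
  rewrite rn_bracketDr //; last by case: hN.
  by rewrite !rn_bracketDl // SL // aS Sa aa2 !addr0.
split=> [[_ _ + _]|g0]; first by rewrite NN KK => /(canRL (addKr _)); rewrite addNr.
by split=> //; rewrite NN KK g0 addr0.
Qed.

End DoubleBracket.

End Concentrated.

End GradedForms.

Lemma ground_field_two_neq0 (R : realType) (g : ground) :
  (2 : ground_field R g) != 0.
Proof.
by case: g; [have := @pnatr_eq0 R 2|have := @pnatr_eq0 (complex R) 2] => /= ->.
Qed.

Theorem theorem2p5p20 (R : realType) (g : ground)
    (E : gradedSpace (ground_field R g)) (l1 l2 l3 alpha : vvform E)
    (hE : concentrated E [:: - 2; - 1])
    (hl1 : symmetric_kform 1 1 l1)
    (hl2 : symmetric_kform 2 1 l2)
    (hl3 : symmetric_kform 3 1 l3)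
    (hmu : Linfty (l1 + l2 + l3))
    (halpha : symmetric_kform 2 0 alpha) :
  Nijenhuis_with_square (l1 + l2 + l3) (euler E + alpha)
    (euler E + 2 *: alpha)
  <->
  (forall X Y Z : E, homog (- 1) X -> homog (- 1) Y -> homog (- 1) Z ->
     alpha [:: l1 [:: alpha [:: X; Y]]; Z]
     + alpha [:: l1 [:: alpha [:: Y; Z]]; X]
     + alpha [:: l1 [:: alpha [:: Z; X]]; Y] = 0).
Proof.
have [mu0 smu _] := hmu.
have mu1 x : (l1 + l2 + l3 : vvform E) [:: x] = l1 [:: x].
  by rewrite !vvformE hl2.1 // hl3.1 // !addr0.
apply: iff_trans (Nijenhuis_double_bracket hE smu halpha) _.
apply: iff_trans (double_bracket_eq0 hE mu0 smu halpha (ground_field_two_neq0 R g)) _.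
by split=> cyc0 X Y Z hX hY hZ; have := cyc0 X Y Z hX hY hZ; rewrite !mu1.
Qed.
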